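(* Let $k$ be an indeterminate and define $$a(k)=10k^2-8k+8,\qquad b(k)=k(k^2-4k+20),\qquad c(k)=(k+2)(k^2-4).$$ Consider the elliptic curve over the rational function field $\mathbb{Q}(k)$ given by $$E:\ y^2=\big(x+a(k)b(k)\big)\big(x+b(k)c(k)\big)\big(x+a(k)c(k)\big).$$ The torsion subgroup of $E(\mathbb{Q}(k))$ is isomorphic to $\mathbb{Z}/2\mathbb{Z}\times\mathbb{Z}/2\mathbb{Z}$.
   Context: When specializing $k$ to a rational number, the values $k=0,\pm2$ are excluded. *)

(* Defs.v *)
From HB Require Import structures.
From mathcomp Require Import all_boot all_order all_algebra.
Set Implicit Arguments. Unset Strict Implicit. Unset Printing Implicit Defensive.
Import Order.TTheory GRing.Theory Num.Theory.
Local Open Scope ring_scope.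

Inductive point (F : Type) := Inf | Pt of F & F.
Arguments Inf {F}.

Section Curve.
Variable F : fieldType.
Variables a2 a4 a6 : F.

Definition on_curve (P : point F) : Prop :=
  match P with
  | Inf => True
  | Pt x y => y ^+ 2 = x ^+ 3 + a2 * x ^+ 2 + a4 * x + a6
  end.

Definition neg_pt (P : point F) : point F :=
  match P with Inf => Inf | Pt x y => Pt x (- y) end.

(* Chord-and-tangent group law (a1 = a3 = 0). *)
Definition add_pt (P Q : point F) : point F :=
  match P, Q with
  | Inf, _ => Q
  | _, Inf => P
  | Pt x1 y1, Pt x2 y2 =>
    if (x1 == x2) && (y1 == - y2) then Inf else
    let l := if x1 == x2
             then (3%:R * x1 ^+ 2 + 2%:R * a2 * x1 + a4) / (2%:R * y1)
             else (y2 - y1) / (x2 - x1) in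
    let x3 := l ^+ 2 - a2 - x1 - x2 in
    Pt x3 (- (l * (x3 - x1) + y1))
  end.

Fixpoint mul_pt (n : nat) (P : point F) : point F :=
  match n with O => Inf | S m => add_pt P (mul_pt m P) end.

Definition torsion_pt (P : point F) : Prop :=
  on_curve P /\ exists n : nat, (0 < n)%N /\ mul_pt n P = Inf.

Definition torsion_iso (G : zmodType) : Prop :=
  exists f : G -> point F,
    [/\ injective f,
        (forall u, on_curve (f u)),
        (forall u v, f (u + v) = add_pt (f u) (f v)) &
        (forall P, torsion_pt P <-> exists u, f u = P)].
End Curve.

Definition Qk := {fraction {poly rat}}.
Definition kk : Qk := tofrac ('X : {poly rat}).

Definition ak : Qk := 10%:R * kk ^+ 2 - 8%:R * kk + 8%:R.
Definition bk : Qk := kk * (kk ^+ 2 - 4%:R * kk + 20%:R).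
Definition ck : Qk := (kk + 2%:R) * (kk ^+ 2 - 4%:R).

(* (x + p)(x + q)(x + r) = x^3 + (p+q+r) x^2 + (pq+qr+rp) x + pqr *)
Definition e1 : Qk := ak * bk.
Definition e2 : Qk := bk * ck.
Definition e3 : Qk := ak * ck.
Definition A2 : Qk := e1 + e2 + e3.
Definition A4 : Qk := e1 * e2 + e2 * e3 + e3 * e1.
Definition A6 : Qk := e1 * e2 * e3.

(* Main.v *)
Require Import Defs.
From HB Require Import structures.
From mathcomp Require Import all_boot all_order all_algebra ring.
Set Implicit Arguments. Unset Strict Implicit. Unset Printing Implicit Defensive.
Import Order.TTheory GRing.Theory Num.Theory.
Local Open Scope ring_scope.
Local Notation "x %:F" := (tofrac x).

(* Let P be a torsion point with y(P) <> 0 and put R = 2P = (X, Y), again a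
   torsion point. The duplication formula gives X + e_i = u_i^2 in Q(k). At every
   place of Q[k] the formal group is torsion free (residue characteristic 0), so
   x(R) and, if Y <> 0, x(2R) are integral; hence y(R) = +- u_1 u_2 u_3 divides
   the derivative of the cubic at X, i.e. sum u_i^2 u_j^2. A prime dividing u_1
   then divides u_2 or u_3, so its square divides u_2^2 - u_1^2 = b(c - a) or
   u_3^2 - u_1^2 = a(c - b); both are squarefree. Thus u_1 is a constant, and
   u_3^2 = a(c - b) + u_1^2 is a square with leading coefficient 60, which is
   absurd. If Y = 0, leading coefficients (60, -1 or -60) also give a
   contradiction. Only the identity P + (P + Q) = 2P + Q is needed from the
   associativity of the group law, to see that 2P is torsion. *)

(** * Chords and tangents *)

Section GroupLaw.
Variable F : fieldType.
Variables a2 a4 a6 : F.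
Hypothesis two_neq0 : 2%:R != 0 :> F.

Local Notation on_curve := (on_curve a2 a4 a6).
Local Notation add_pt := (add_pt a2 a4).
Local Notation mul_pt := (mul_pt a2 a4).

(** Characterising the slope by a linear equation, not as a quotient, keeps denominators out of the
    later [ring] computations. *)
Lemma add_pt_chord l x1 y1 x2 y2 (x3 := l ^+ 2 - a2 - x1 - x2) :
  x1 != x2 -> l * (x2 - x1) = y2 - y1 ->
  add_pt (Pt x1 y1) (Pt x2 y2) = Pt x3 (- (l * (x3 - x1) + y1)).
Proof.
move=> n12 hl; rewrite /add_pt (negbTE n12) /= -hl mulfK //.
by rewrite subr_eq0 eq_sym.
Qed.

Lemma eqr_opp_self (y : F) : (y == - y) = (y == 0).
Proof.
by rewrite -subr_eq0 opprK -mulr2n -mulr_natl mulf_eq0 (negbTE two_neq0).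
Qed.

Lemma add_pt_tangent l x1 y1 (x3 := l ^+ 2 - a2 - x1 - x1) :
  y1 != 0 -> l * (2%:R * y1) = 3%:R * x1 ^+ 2 + 2%:R * a2 * x1 + a4 ->
  add_pt (Pt x1 y1) (Pt x1 y1) = Pt x3 (- (l * (x3 - x1) + y1)).
Proof.
move=> y0 hl; rewrite /add_pt eqxx eqr_opp_self (negbTE y0) /= -hl mulfK //.
by rewrite mulf_neq0.
Qed.

Lemma add_pt_neg x1 y1 : add_pt (Pt x1 y1) (Pt x1 (- y1)) = Inf.
Proof. by rewrite /add_pt opprK !eqxx. Qed.

Lemma add_neg_pt x1 y1 : add_pt (Pt x1 (- y1)) (Pt x1 y1) = Inf.
Proof. by rewrite /add_pt !eqxx. Qed.

Lemma tangent_slope x1 y1 : y1 != 0 ->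
  exists l, l * (2%:R * y1) = 3%:R * x1 ^+ 2 + 2%:R * a2 * x1 + a4.
Proof.
move=> y0; exists ((3%:R * x1 ^+ 2 + 2%:R * a2 * x1 + a4) / (2%:R * y1)).
by rewrite divfK // mulf_neq0.
Qed.

Lemma chord_slope x1 y1 x2 y2 : x1 != x2 :> F ->
  exists l : F, l * (x2 - x1) = y2 - y1.
Proof.
move=> n12; exists ((y2 - y1) / (x2 - x1)).
by rewrite divfK // subr_eq0 eq_sym.
Qed.

Lemma on_curve_same_x x y1 y2 :
  on_curve (Pt x y1) -> on_curve (Pt x y2) -> y2 = y1 \/ y2 = - y1.
Proof.
move=> /= h1 h2; have := eqf_sqr y2 y1; rewrite h1 h2 eqxx => /esym/orP.
by case=> /eqP; [left|right].
Qed.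

Lemma on_curve_add P Q : on_curve P -> on_curve Q -> on_curve (add_pt P Q).
Proof.
case: P Q => [|x1 y1] [|x2 y2] //; have [->|n12] := eqVneq x1 x2.
  move=> h1 h2; have [->|->] := on_curve_same_x h1 h2; last by rewrite add_pt_neg.
  have [->|y0] := eqVneq y1 0; first by rewrite -{2}oppr0 add_pt_neg.
  have [l hl] := tangent_slope x2 y0.
  rewrite (add_pt_tangent y0 hl) /=; move: h1 => /= h1.
  (* The curve equation eliminates [a6] and the slope equation eliminates [a4]; what remains is a
     polynomial identity. *)
  have -> : a6 = y1 ^+ 2 - x2 ^+ 3 - a2 * x2 ^+ 2 - a4 * x2.
    by rewrite h1; ring.
  have -> : a4 = l * (2%:R * y1) - 3%:R * x2 ^+ 2 - 2%:R * a2 * x2.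
    by rewrite hl; ring.
  by ring.
have [l hl] := chord_slope y1 y2 n12.
rewrite (add_pt_chord n12 hl) /= => h1 h2.
have d : x2 - x1 != 0 by rewrite subr_eq0 eq_sym.
have -> : a6 = y1 ^+ 2 - x1 ^+ 3 - a2 * x1 ^+ 2 - a4 * x1 by rewrite h1; ring.
(* In the chord case [a4] comes from the difference of the two curve equations, divided by
   [x2 - x1]. *)
have -> : a4 = l * (2%:R * y1 + l * (x2 - x1)) - (x1 ^+ 2 + x1 * x2 + x2 ^+ 2)
               - a2 * (x1 + x2).
  apply: (mulIf d); transitivity ((y1 + l * (x2 - x1)) ^+ 2 - y1 ^+ 2
    - (x2 ^+ 3 - x1 ^+ 3) - a2 * (x2 ^+ 2 - x1 ^+ 2)); last by ring.
  have -> : y1 + l * (x2 - x1) = y2 by rewrite hl addrC subrK.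
  by rewrite h2 h1; ring.
by ring.
Qed.

Lemma on_curve_mul n P : on_curve P -> on_curve (mul_pt n P).
Proof. by move=> hP; elim: n => //= n IH; exact: on_curve_add. Qed.

(** Write P for [Pt x1 y1]. The degenerate positions Q = P, Q = -P, Q = -2P and Q = 2P are split
    off; the generic case is an identity of rational functions. *)
Lemma add_pt_alternative x1 y1 Q : y1 != 0 ->
  on_curve (Pt x1 y1) -> on_curve Q ->
  add_pt (Pt x1 y1) (add_pt (Pt x1 y1) Q) =
  add_pt (add_pt (Pt x1 y1) (Pt x1 y1)) Q.
Proof.
move=> y0 hP; case: Q => [_|x2 y2 hQ].
  by rewrite {2}/add_pt; case: (add_pt (Pt x1 y1) (Pt x1 y1)).
have [la hla] := tangent_slope x1 y0.
rewrite (add_pt_tangent y0 hla); set xd := _ - x1 - x1; set yd := - _.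
have hyd : yd = - (la * (xd - x1) + y1) by [].
have [e12|n12] := eqVneq x1 x2.
  rewrite -e12 in hQ *; have [->|->] := on_curve_same_x hP hQ.
    rewrite (add_pt_tangent y0 hla) -/xd -/yd.
    have [ed|nd] := eqVneq xd x1.
      by rewrite hyd ed subrr mulr0 add0r add_pt_neg add_neg_pt.
    have dd : xd - x1 != 0 by rewrite subr_eq0.
    have nd' : x1 != xd by rewrite eq_sym.
    have [m hm] := chord_slope y1 yd nd'.
    have hm' : m * (x1 - xd) = y1 - yd by rewrite -opprB mulrN hm opprB.
    rewrite (add_pt_chord nd' hm) (add_pt_chord nd hm').
    have -> : y1 = yd - m * (xd - x1) by rewrite hm; ring.
    by congr Pt; ring.
  rewrite add_pt_neg {1}/add_pt.
  (* Here Q = -P. If [xd = x1] then 2P = -P, and the sum of 2P and Q is the double of -P, with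
     tangent slope [- la]. *)
  have [ed|nd] := eqVneq xd x1.
    rewrite hyd ed subrr mulr0 add0r (@add_pt_tangent (- la)) ?oppr_eq0 //.
      by rewrite sqrrN -/xd ed subrr mulr0 add0r opprK.
    by rewrite -hla; ring.
  rewrite (@add_pt_chord (- la)) // ?sqrrN; last by rewrite hyd; ring.
  have -> : la ^+ 2 = xd + a2 + x1 + x1 by rewrite /xd; ring.
  by rewrite hyd; congr Pt; ring.
have [l hl] := chord_slope y1 y2 n12.
have d0 : x2 - x1 != 0 by rewrite subr_eq0 eq_sym.
rewrite (add_pt_chord n12 hl); set x3 := _ - x2; set y3 := - _.
have hy3 : y3 = - (l * (x3 - x1) + y1) by [].
(* Through this divided difference of slopes, [l], [y2], [x3], [a2] and [xd] become polynomials in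
   [x1], [x2], [y1], [la] and [mu]. *)
pose mu := (l - la) / (x2 - x1).
have hlm : l = la + mu * (x2 - x1) by rewrite divfK // addrC subrK.
have hy2 : y2 = y1 + l * (x2 - x1) by rewrite hl addrC subrK.
have h31 : x3 = x1 - 2%:R * mu * y1.
  apply: (mulIf d0); apply: (mulIf d0).
  transitivity ((y1 + l * (x2 - x1)) ^+ 2 - y1 ^+ 2 - 2%:R * y1 * l * (x2 - x1)
    - (a2 + x1 + x2) * (x2 - x1) ^+ 2); first by rewrite /x3; ring.
  transitivity (x1 * (x2 - x1) ^+ 2 - 2%:R * y1 * (mu * (x2 - x1)) * (x2 - x1));
    last by ring.
  rewrite -hy2 hQ hP divfK //.
  transitivity (x1 * (x2 - x1) ^+ 2 - 2%:R * y1 * l * (x2 - x1)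
    + la * (2%:R * y1) * (x2 - x1)); last by ring.
  by rewrite hla; ring.
have ha2 : a2 = l ^+ 2 - x1 - x1 - x2 + 2%:R * mu * y1.
  have -> : 2%:R * mu * y1 = x1 - x3 by rewrite h31; ring.
  by rewrite /x3; ring.
(* [x3 = x1] forces [mu = 0]: the tangent at P passes through Q, so Q = -2P and both sides are
   [Inf]. *)
have [e31|n31] := eqVneq x3 x1.
  have mu0 : mu = 0.
    apply/eqP; move/eqP: h31; rewrite e31 -subr_eq0 opprB addrC subrK.
    by rewrite mulf_eq0 (negbTE y0) orbF mulf_eq0 (negbTE two_neq0).
  have lla : la = l by rewrite hlm mu0 mul0r addr0.
  have ed : xd = x2 by rewrite /xd lla {1}ha2 mu0; ring.
  rewrite hy3 e31 subrr mulr0 add0r add_pt_neg hyd ed lla hl.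
  by rewrite subrK add_neg_pt.
have mu0 : mu != 0.
  by apply: contraNneq n31 => mu0; rewrite h31 mu0 mulr0 mul0r subr0.
have n13 : x1 != x3 by rewrite eq_sym.
(* The slope from P to P + Q: [y3 - y1] is [- l * (x3 - x1) - 2 y1], and [x3 - x1] is
   [- 2 mu y1]. *)
rewrite (@add_pt_chord (mu^-1 - l)) //; last first.
  by rewrite hy3 h31; field.
have exd : xd = x2 - mu * ((x2 - x1) * (la + l) + 2%:R * y1).
  rewrite /xd ha2.
  transitivity (x2 + (la - l) * (la + l) - 2%:R * mu * y1); first by ring.
  have -> : la - l = - (mu * (x2 - x1)) by rewrite divfK // opprB.
  by ring.
(* [xd = x2] leaves only Q = 2P, since Q = -2P belongs to the case [x3 = x1]; the right-hand side is
   then a doubling. *)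
have [ed|nd] := eqVneq xd x2.
  have hs : (x2 - x1) * (la + l) + 2%:R * y1 = 0.
    apply/eqP; move/eqP: exd; rewrite ed eq_sym -subr_eq0 addrC addKr oppr_eq0.
    by rewrite mulf_eq0 (negbTE mu0).
  have ey : yd = y2.
    apply/eqP; rewrite -subr_eq0.
    have -> : yd - y2 = - ((x2 - x1) * (la + l) + 2%:R * y1).
      by rewrite hyd hy2 ed; ring.
    by rewrite hs oppr0.
  have y20 : y2 != 0.
    apply: contraNneq mu0 => y20; rewrite /mu.
    have -> : l - la = 0.
      apply: (mulIf d0); rewrite mul0r mulrBl hl.
      have -> : la * (x2 - x1) = - yd - y1 by rewrite hyd ed; ring.
      by rewrite ey y20; ring.
    by rewrite mul0r.
  have hm : (3%:R * x2 ^+ 2 + 2%:R * a2 * x2 + a4) / (2%:R * y2) * (2%:R * y2)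
      = 3%:R * x2 ^+ 2 + 2%:R * a2 * x2 + a4 by rewrite divfK // mulf_neq0.
  rewrite ed ey (add_pt_tangent y20 hm).
  have hy1 : y1 = - ((x2 - x1) * (la + l)) / 2%:R.
    apply: (mulIf two_neq0); rewrite divfK //.
    by apply/eqP; rewrite -addr_eq0 -hs; apply/eqP; ring.
  have ha4 : a4 = la * (2%:R * y1) - 3%:R * x1 ^+ 2 - 2%:R * a2 * x1.
    by rewrite hla; ring.
  have hx2 : x2 = x1 + (x2 - x1) by rewrite addrC subrK.
  rewrite h31 ha4 ha2 in y20 *; rewrite hy2 hy1 hlm in y20 *.
  rewrite hx2 in y20 d0 *; move: (x2 - x1) (mu) (la) y20 d0 mu0 two_neq0.
  move=> d u s y20 d0 u0 t0.
  rewrite (_ : x1 + d - x1 = d) in y20 d0 *; last by ring.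
  (* Twice the ordinate of Q, in the shape of the side condition produced by [field]. *)
  have y20' : - (d * (s + (s + u * d))) + (s + u * d) * d * 2%:R != 0.
    have -> : - (d * (s + (s + u * d))) + (s + u * d) * d * 2%:R = u * d * d.
      by ring.
    by rewrite !mulf_neq0.
  by congr Pt; field; rewrite t0 u0 y20'.
rewrite (@add_pt_chord ((y2 - yd) / (x2 - xd))) //; last first.
  by rewrite divfK // subr_eq0 eq_sym.
have : x2 - xd != 0 by rewrite subr_eq0 eq_sym.
rewrite hyd exd h31 ha2 hy2 hlm => nz.
by congr Pt; field; rewrite mu0 nz.
Qed.

Lemma add_pt_double_eq0 x : add_pt (Pt x 0) (Pt x 0) = Inf.
Proof. by rewrite -{2}[0]oppr0 add_pt_neg. Qed.

Lemma mul_ptS n P : mul_pt n.+1 P = add_pt P (mul_pt n P).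
Proof. by []. Qed.

Lemma mul_pt_double n x y : y != 0 -> on_curve (Pt x y) ->
  mul_pt n (add_pt (Pt x y) (Pt x y)) = mul_pt n.*2 (Pt x y).
Proof.
move=> y0 hP; elim: n => // n IH.
by rewrite doubleS !mul_ptS IH add_pt_alternative //; exact: on_curve_mul.
Qed.

Lemma mul_pt_addn_eq0 m n P : mul_pt n P = Inf -> mul_pt (m + n) P = mul_pt m P.
Proof. by move=> hn; elim: m => // m IH; rewrite addSn !mul_ptS IH. Qed.

(** The same n kills 2P, because n(2P) = (n + n)P = nP; if y = 0 then 2P is already [Inf]. *)
Lemma torsion_double P : torsion_pt a2 a4 a6 P ->
  torsion_pt a2 a4 a6 (add_pt P P).
Proof.
case=> hP [n [n0 hn]]; split; first exact: on_curve_add.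
exists n; split=> //; case: P => [|x y] in hP hn *.
  by elim: (n) => //= k ->.
have [e|y0] := eqVneq y 0; last by rewrite mul_pt_double // -addnn mul_pt_addn_eq0.
by rewrite e add_pt_double_eq0; elim: (n) => //= k ->.
Qed.
End GroupLaw.

(** * Integrality of torsion points *)

(* A valuation ring [vO] of [F] with maximal ideal [vM], of residue
   characteristic zero. *)
Record valuation_ring (F : fieldType) (vO vM : F -> Prop) : Prop := {
  vO_nat : forall n, vO n%:R;
  vO_opp : forall z, vO z -> vO (- z);
  vO_add : forall z w, vO z -> vO w -> vO (z + w);
  vO_mul : forall z w, vO z -> vO w -> vO (z * w);
  vM_sub : forall z, vM z -> vO z;
  vM_0 : vM 0;
  vM_add : forall z w, vM z -> vM w -> vM (z + w);
  vM_mul : forall z w, vO z -> vM w -> vM (z * w);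
  vM_nat : forall n, ~ vM n.+1%:R;
  vO_unit : forall z, vO z -> vM z \/ vO z^-1;
  vO_total : forall z, vO z \/ vM z^-1 }.

Section Integrality.
Variables (F : fieldType) (vO vM : F -> Prop).
Hypothesis vR : valuation_ring vO vM.

Lemma vO1 : vO 1. Proof. exact: (vO_nat vR 1). Qed.

Lemma vO_sub z w : vO z -> vO w -> vO (z - w).
Proof. by move=> hz hw; apply: (vO_add vR) => //; exact: (vO_opp vR). Qed.

Lemma vO_exp z n : vO z -> vO (z ^+ n).
Proof.
move=> hz; elim: n => [|n IH]; first exact: vO1.
by rewrite exprS; exact: (vO_mul vR).
Qed.

Lemma vM_opp z : vM z -> vM (- z).
Proof.
rewrite -mulN1r; apply: (vM_mul vR); apply: (vO_opp vR); exact: vO1.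
Qed.

Lemma vM_nonunit z : vO z^-1 -> vM z -> z = 0.
Proof.
move=> hV hz; apply/eqP/negP => /negP z0; apply: (vM_nat vR (n := 0)).
by rewrite -(mulVf z0); exact: (vM_mul vR).
Qed.

Lemma vM_prime z w : vO z -> vM (z * w) -> vM z \/ vM w.
Proof.
move=> hz hzw; have [|hV] := vO_unit vR hz; first by left.
have [->|z0] := eqVneq z 0; first by left; exact: (vM_0 vR).
by right; rewrite -(mulKf z0 w); exact: (vM_mul vR).
Qed.

Lemma vM_sqr z : vO z -> vM (z ^+ 2) -> vM z.
Proof. by move=> hz; rewrite expr2 => /(vM_prime hz) []. Qed.

(** A valuation ring is integrally closed: if [z^-1] lies in [vM], then [z = z^2 * z^-1] is
    integral. *)
Lemma vO_sqr z : vO (z ^+ 2) -> vO z.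
Proof.
move=> hz; have [//|hV] := vO_total vR z.
rewrite (_ : z = z ^+ 2 * z^-1); first exact/(vM_sub vR)/(vM_mul vR).
by have [->|z0] := eqVneq z 0; rewrite ?invr0 ?mulr0 // expr2 mulfK.
Qed.

Lemma natf_neq0 n : n.+1%:R != 0 :> F.
Proof. by apply/negP => /eqP e; apply: (vM_nat vR (n := n)); rewrite e; exact: (vM_0 vR). Qed.

Lemma vO_natV n : vO n.+1%:R^-1.
Proof. by have [/(vM_nat vR)|] := vO_unit vR (vO_nat vR n.+1). Qed.

(** Congruence modulo the maximal ideal. Integrality of [c] is bundled, as compatibility with
    products relies on it. *)
Definition near (z c : F) := vO c /\ vM (z - c).

Lemma near_vO z c : near z c -> vO z.
Proof.
case=> hc hz; rewrite -(subrK c z); apply: (vO_add vR) => //; exact: (vM_sub vR).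
Qed.

Lemma nearD z c w d : near z c -> near w d -> near (z + w) (c + d).
Proof.
case=> hc hz [hd hw]; split; first exact: (vO_add vR).
by rewrite (_ : _ - _ = (z - c) + (w - d)); [exact: (vM_add vR)|ring].
Qed.

Lemma nearN z c : near z c -> near (- z) (- c).
Proof.
case=> hc hz; split; first exact: (vO_opp vR).
by rewrite -opprD; exact: vM_opp.
Qed.

Lemma nearB z c w d : near z c -> near w d -> near (z - w) (c - d).
Proof. by move=> hz hw; apply: nearD => //; exact: nearN. Qed.

Lemma nearM z c w d : near z c -> near w d -> near (z * w) (c * d).
Proof.
move=> hzc hwd; have hz := near_vO hzc; case: hzc hwd => hc hzc [hd hwd].
split; first exact: (vO_mul vR).
have -> : z * w - c * d = z * (w - d) + d * (z - c) by ring.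
by apply: (vM_add vR); exact: (vM_mul vR).
Qed.

Lemma nearX z c n : near z c -> near (z ^+ n) (c ^+ n).
Proof.
move=> hz; elim: n => [|n IH]; last by rewrite !exprS; exact: nearM.
by split; [exact: vO1|rewrite subrr; exact: (vM_0 vR)].
Qed.

Lemma near_refl c : vO c -> near c c.
Proof. by move=> hc; split=> //; rewrite subrr; exact: (vM_0 vR). Qed.

Lemma near0 z : vM z -> near z 0.
Proof. by move=> hz; split; [exact: (vO_nat vR 0)|rewrite subr0]. Qed.

Lemma near_neq0 z c : near z c -> c != 0 -> vO c^-1 -> z != 0.
Proof.
case=> hc hz c0 hV; apply: contraNneq c0 => z0; move: hz.
by rewrite z0 sub0r => /vM_opp; rewrite opprK => /(vM_nonunit hV) ->.
Qed.

Lemma nearV z c : near z c -> c != 0 -> vO c^-1 -> near z^-1 c^-1.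
Proof.
move=> h c0 hV; have z0 := near_neq0 h c0 hV; split=> //.
have -> : z^-1 - c^-1 = z^-1 * c^-1 * - (z - c) by field; rewrite z0 c0.
apply: (vM_mul vR); last by case: h => _; exact: vM_opp.
apply: (vO_mul vR) => //; have [hz|//] := vO_unit vR (near_vO h).
case: h => hc h; case/eqP: c0; apply: vM_nonunit => //.
by rewrite -(subKr z c); apply: (vM_add vR) => //; exact: vM_opp.
Qed.

Variables a2 a4 a6 : F.
Hypotheses (a2O : vO a2) (a4O : vO a4) (a6O : vO a6).

Local Notation on_curve := (on_curve a2 a4 a6).
Local Notation add_pt := (add_pt a2 a4).
Local Notation mul_pt := (mul_pt a2 a4).

(* On the formal group, [x / y] is a parameter [z] with [z(nP) ~ n z(P)],
   [x ~ z ^- 2] and [y ~ z ^- 3]; here [w = 1 / z(P)]. *)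
Definition formal_multiple (w : F) n (P : point F) :=
  if P is Pt x y then near (x / w ^+ 2) (n%:R ^- 2) /\ near (y / w ^+ 3) (n%:R ^- 3)
  else False.

(** * Multiples of a point of the formal group *)

Section Multiples.
Variables (w x y : F).
Hypotheses (wM : vM w^-1) (w0 : w != 0).
Hypothesis hP : formal_multiple w 1 (Pt x y).

Let hx : near (x / w ^+ 2) 1.
Proof. by case: hP; rewrite mulr1n !expr1n invr1. Qed.
Let hy : near (y / w ^+ 3) 1.
Proof. by case: hP; rewrite mulr1n !expr1n invr1. Qed.

Let hX2 : near (a2 / w ^+ 2) 0.
Proof.
apply: near0; apply: (vM_mul vR) => //; rewrite -exprVn expr2.
by apply: (vM_mul vR) => //; exact: (vM_sub vR).
Qed.

Let hX4 : near (a4 / w ^+ 4) 0.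
Proof.
apply: near0; apply: (vM_mul vR) => //; rewrite -exprVn exprS.
by rewrite mulrC; apply: (vM_mul vR) => //; apply/vO_exp/(vM_sub vR).
Qed.

(** After scaling by powers of [w] the coefficients lie in [vM], so the computation reduces to
    doubling (1, 1) on the cuspidal cubic y^2 = x^3: slope 3/2, result (1/4, 1/8). *)
Lemma formal_double : formal_multiple w 2 (add_pt (Pt x y) (Pt x y)).
Proof.
have y0 : y != 0.
  have : y / w ^+ 3 != 0 by apply: near_neq0 hy _ _; rewrite ?oner_neq0 ?invr1 //; exact: vO1.
  by apply: contraNneq => ->; rewrite mul0r.
have t0 := natf_neq0 1; have tO := vO_natV 1.
pose l := (3%:R * x ^+ 2 + 2%:R * a2 * x + a4) / (2%:R * y).
have hl : l * (2%:R * y) = 3%:R * x ^+ 2 + 2%:R * a2 * x + a4.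
  by rewrite divfK // mulf_neq0.
rewrite (add_pt_tangent t0 y0 hl); set x3 := _ - x - x.
have nat_near n : near n%:R n%:R by exact/near_refl/(vO_nat vR).
have nl : near (l / w) (3%:R / 2%:R).
  have -> : l / w = (3%:R * (x / w ^+ 2) ^+ 2 + 2%:R * (a2 / w ^+ 2) * (x / w ^+ 2)
     + a4 / w ^+ 4) * 2%:R^-1 * (y / w ^+ 3)^-1.
    by rewrite /l; field; rewrite t0 y0 w0.
  have -> : 3%:R / 2%:R = (3%:R * 1 ^+ 2 + 2%:R * 0 * 1 + 0) * 2%:R^-1 * 1^-1 :> F.
    by rewrite invr1; field.
  apply: nearM; last by apply: nearV hy _ _; rewrite ?oner_neq0 ?invr1 //; exact: vO1.
  apply: nearM; last exact: near_refl.
  apply: nearD => //; apply: nearD; first by apply: nearM => //; exact: nearX.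
  by apply: nearM => //; apply: nearM.
have nx3 : near (x3 / w ^+ 2) (2%:R ^- 2).
  have -> : x3 / w ^+ 2 = (l / w) ^+ 2 - a2 / w ^+ 2 - x / w ^+ 2 - x / w ^+ 2.
    by rewrite /x3; field.
  have -> : 2%:R ^- 2 = (3%:R / 2%:R) ^+ 2 - 0 - 1 - 1 :> F.
    by field; rewrite !natf_neq0.
  by apply: nearB => //; apply: nearB => //; apply: nearB => //; exact: nearX.
split=> //.
have -> : - (l * (x3 - x) + y) / w ^+ 3 =
    - ((l / w) * (x3 / w ^+ 2 - x / w ^+ 2) + y / w ^+ 3) by field.
have -> : 2%:R ^- 3 = - ((3%:R / 2%:R) * (2%:R ^- 2 - 1) + 1) :> F.
  by field; rewrite !natf_neq0.
by apply/nearN/nearD => //; apply: nearM => //; exact: nearB.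
Qed.

(** Modulo [vM] this is the chord on y^2 = x^3 through (1, 1) and (N^-2, N^-3) with N = m + 2. It
    needs N^-2 - 1 to be a unit, which holds in residue characteristic zero as N is at least 2. *)
Lemma formal_succ m Q : formal_multiple w m.+2 Q ->
  formal_multiple w m.+3 (add_pt (Pt x y) Q).
Proof.
case: Q => // xn yn [hxn hyn].
have := natf_neq0 m; have := natf_neq0 m.+1; have := natf_neq0 m.+2.
have := vO_natV m; have := vO_natV m.+2; have := vO_nat vR m.+2.
have := vO_natV m.+1.
have eN1 : m.+1%:R = m.+2%:R - 1 :> F by rewrite -[m.+2]addn1 natrD addrK.
have eN3 : m.+3%:R = m.+2%:R + 1 :> F by rewrite -[m.+3]addn1 natrD.
(* The index becomes a field element [N] with [N - 1], [N] and [N + 1] nonzero, so that [field] can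
   treat it as a variable. *)
move: hxn hyn; rewrite /formal_multiple eN1 eN3; move: m.+2%:R => N hxn hyn.
move=> NVO NO N3VO N1VO N30 N0 N10.
have eN : N ^- 2 - 1 = - ((N - 1) * (N + 1)) / N ^+ 2 by field.
have c0 : N ^- 2 - 1 != 0.
  by rewrite eN mulf_neq0 ?invr_eq0 ?expf_neq0 // oppr_eq0 mulf_neq0.
have eNV : (N ^- 2 - 1)^-1 = - (N ^+ 2 * (N - 1)^-1 * (N + 1)^-1).
  by rewrite eN; field; rewrite N30 N10 N0 oppr_eq0 mulf_neq0.
have cV : vO (N ^- 2 - 1)^-1.
  rewrite eNV; apply: (vO_opp vR); do 2! apply: (vO_mul vR) => //.
  exact: vO_exp.
have ndx := nearB hxn hx; have nz := near_neq0 ndx c0 cV.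
have dx0 : xn - x != 0.
  by apply: contraNneq nz; rewrite -mulrBl => ->; rewrite mul0r.
pose l := (yn - y) / (xn - x).
have hl : l * (xn - x) = yn - y by rewrite divfK.
have nx : x != xn by rewrite eq_sym -subr_eq0.
rewrite (add_pt_chord a2 a4 nx hl); set x3 := _ - x - xn.
have nl : near (l / w) ((N ^- 3 - 1) * (N ^- 2 - 1)^-1).
  have -> : l / w = (yn / w ^+ 3 - y / w ^+ 3) * (xn / w ^+ 2 - x / w ^+ 2)^-1.
    by rewrite /l; field; rewrite dx0 w0.
  by apply: nearM; [exact: nearB|exact: nearV].
have nx3 : near (x3 / w ^+ 2) ((N + 1) ^- 2).
  have -> : x3 / w ^+ 2 = (l / w) ^+ 2 - a2 / w ^+ 2 - x / w ^+ 2 - xn / w ^+ 2.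
    by rewrite /x3; field.
  have -> : (N + 1) ^- 2 =
      ((N ^- 3 - 1) * (N ^- 2 - 1)^-1) ^+ 2 - 0 - 1 - N ^- 2.
    by rewrite eNV; field; rewrite N30 N10 N0.
  by apply: nearB => //; apply: nearB => //; apply: nearB => //; exact: nearX.
split=> //.
have -> : - (l * (x3 - x) + y) / w ^+ 3 =
    - ((l / w) * (x3 / w ^+ 2 - x / w ^+ 2) + y / w ^+ 3) by field.
have -> : (N + 1) ^- 3 =
    - (((N ^- 3 - 1) * (N ^- 2 - 1)^-1) * ((N + 1) ^- 2 - 1) + 1).
  by rewrite eNV; field; rewrite N30 N10 N0.
by apply/nearN/nearD => //; apply: nearM => //; exact: nearB.
Qed.

Lemma formal_mul n : formal_multiple w n.+1 (mul_pt n.+1 (Pt x y)).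
Proof.
elim: n => [|[|n] IH]; first exact: hP; first exact: formal_double.
by rewrite mul_ptS; exact: formal_succ.
Qed.
End Multiples.

(** If [x] had a pole, the point would lie in the formal group, and by [formal_mul] all its positive
    multiples would be finite points. *)
Lemma torsion_integral x y : torsion_pt a2 a4 a6 (Pt x y) -> vO x.
Proof.
case=> hP [[|n] [n0 hn]] //.
have [//|xM] := vO_total vR x.
(* The convention [0^-1 = 0] puts the inverse of 0 in [vM], so [x = 0] is treated apart. *)
have [->|x0] := eqVneq x 0; first exact: (vO_nat vR 0).
have xO := vM_sub vR xM.
pose w := y / x.
(* Divide the curve equation by [x ^+ 3]. *)
have n1 : near (w ^+ 2 / x) 1.
  have -> : w ^+ 2 / x = 1 + (a2 + a4 / x + a6 / x ^+ 2) * x^-1.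
    have -> : w ^+ 2 / x = y ^+ 2 / x ^+ 3 by rewrite /w; field.
    by rewrite hP; field.
  split; first exact: vO1.
  rewrite addrC addKr; apply: (vM_mul vR) => //.
  apply: (vO_add vR); first by apply: (vO_add vR) => //; exact: (vO_mul vR).
  by apply: (vO_mul vR) => //; rewrite -exprVn; exact: vO_exp.
have V1 : vO 1^-1 by rewrite invr1; exact: vO1.
have w20 : w ^+ 2 != 0.
  by apply: contraNneq (near_neq0 n1 (oner_neq0 _) V1) => ->; rewrite mul0r.
have w0 : w != 0 by move: w20; rewrite expf_eq0.
have y0 : y != 0 by apply: contraNneq w0 => y0; rewrite /w y0 mul0r.
have n1' : near (x / w ^+ 2) 1.
  by have := nearV n1 (oner_neq0 _) V1; rewrite invr1 invf_div.
have wM2 : vM (w^-1 ^+ 2).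
  have -> : w^-1 ^+ 2 = x / w ^+ 2 * x^-1 by field; rewrite w0 x0.
  by apply: (vM_mul vR) => //; exact: near_vO n1'.
have wM : vM w^-1 by apply: vM_sqr (wM2); apply: vO_sqr; exact: (vM_sub vR).
have fP : formal_multiple w 1 (Pt x y).
  rewrite /formal_multiple mulr1n !expr1n invr1; split=> //.
  by have -> : y / w ^+ 3 = x / w ^+ 2 by rewrite /w; field; rewrite x0 y0.
by have := formal_mul wM w0 fP n; rewrite hn.
Qed.

End Integrality.

(* At a place of good or multiplicative reduction, a torsion point that is a
   double can only meet a 2-torsion point at a node of the reduced curve. *)
Lemma torsion_double_node (F : fieldType) (vO vM : F -> Prop)
    (vR : valuation_ring vO vM) (e1 e2 e3 x y u1 u2 u3 : F) :
  vO e1 -> vO e2 -> vO e3 -> y != 0 ->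
  torsion_pt (e1 + e2 + e3) (e1 * e2 + e2 * e3 + e3 * e1) (e1 * e2 * e3) (Pt x y) ->
  u1 ^+ 2 = x + e1 -> u2 ^+ 2 = x + e2 -> u3 ^+ 2 = x + e3 ->
  [/\ vO u1, vO u2, vO u3 & vM u1 -> vM u2 \/ vM u3].
Proof.
set a2 := e1 + _ + _; set a4 := _ + _ + e3 * e1; set a6 := _ * e3.
move=> O1 O2 O3 y0 tP h1 h2 h3.
have a2O : vO a2 by apply: (vO_add vR) => //; exact: (vO_add vR).
have a4O : vO a4.
  by apply: (vO_add vR); first apply: (vO_add vR); exact: (vO_mul vR).
have a6O : vO a6 by apply: (vO_mul vR) => //; exact: (vO_mul vR).
have t0 := natf_neq0 vR 1.
have xO := torsion_integral vR a2O a4O a6O tP.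
have uO u e : vO e -> u ^+ 2 = x + e -> vO u.
  by move=> he hu; apply: (vO_sqr vR); rewrite hu; exact: (vO_add vR).
have u1O := uO _ _ O1 h1; have u2O := uO _ _ O2 h2; have u3O := uO _ _ O3 h3.
split=> // u1M.
(* The double of the point has an integral abscissa, so the tangent slope [l] is integral too; since
   [l * (2 y)] is the derivative of the cubic at [x], that derivative lies in [vM] along with
   [y]. *)
have [l hl] := tangent_slope a2 a4 t0 x y0.
have := torsion_double t0 tP; rewrite (add_pt_tangent t0 y0 hl).
move=> /(torsion_integral vR a2O a4O a6O) dO.
have lO : vO l.
  apply: (vO_sqr vR).
  have -> : l ^+ 2 = (l ^+ 2 - a2 - x - x) + (a2 + x + x) by ring.
  by do 2! apply: (vO_add vR) => //; exact: (vO_add vR).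
have hy : y ^+ 2 = (u1 * u2 * u3) ^+ 2.
  case: tP => /= -> _; rewrite !exprMn h1 h2 h3 /a2 /a4 /a6; ring.
have uM : vM (u1 * u2 * u3).
  by rewrite -mulrA mulrC; apply: (vM_mul vR) => //; exact: (vO_mul vR).
have yM : vM y.
  have := eqf_sqr y (u1 * u2 * u3); rewrite hy eqxx => /esym/orP.
  by case=> /eqP -> //; exact: (vM_opp vR).
have dM : vM (3%:R * x ^+ 2 + 2%:R * a2 * x + a4).
  rewrite -hl; apply: (vM_mul vR) => //; apply: (vM_mul vR) => //; exact: (vO_nat vR).
(* The derivative is the sum of the products [u_i^2 u_j^2]; modulo [u1] only [(u2 * u3) ^+ 2]
   survives. *)
have : vM ((u2 * u3) ^+ 2).
  have -> : (u2 * u3) ^+ 2 = (3%:R * x ^+ 2 + 2%:R * a2 * x + a4)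
      - (u1 * (u2 ^+ 2 + u3 ^+ 2)) * u1.
    transitivity ((u2 ^+ 2) * (u3 ^+ 2)); first by ring.
    transitivity ((3%:R * x ^+ 2 + 2%:R * a2 * x + a4)
      - u1 ^+ 2 * (u2 ^+ 2 + u3 ^+ 2)); last by ring.
    by rewrite h1 h2 h3 /a2 /a4; ring.
  apply: (vM_add vR) => //; apply/(vM_opp vR)/(vM_mul vR) => //.
  apply: (vO_mul vR) => //; apply: (vO_add vR); exact: (vO_exp vR).
by move/(vM_sqr vR (vO_mul vR u2O u3O))/(vM_prime vR u2O).
Qed.

(** * Places of a rational function field *)

Lemma frac_numden (R : idomainType) (z : {fraction R}) :
  exists p q : R, q != 0 /\ z = p%:F / q%:F.
Proof.
exists (frac (repr z)).1, (frac (repr z)).2.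
have d0 := denom_ratioP (repr z); split=> //.
apply: (canRL (mulfK _)); first by rewrite tofrac_eq0.
rewrite -{1}[z]reprK; move: (repr z) d0 => r d0.
apply/eqP; rewrite -[_ * _]/(FracField.mul _ _) !piE /FracField.mulf.
by rewrite /equivf /= !numden_Ratio ?mulr1 ?oner_neq0 // mulrC.
Qed.

Lemma frac_coprime (K : fieldType) (z : {fraction {poly K}}) :
  exists p q : {poly K}, [/\ q != 0, coprimep p q & z = p%:F / q%:F].
Proof.
have [p [q [q0 ->]]] := frac_numden z; set g := gcdp p q.
have g0 : g != 0 by rewrite gcdp_eq0 negb_and q0 orbT.
have hp : p = p %/ g * g by rewrite divpK // dvdp_gcdl.
have hq : q = q %/ g * g by rewrite divpK // dvdp_gcdr.
have q'0 : q %/ g != 0 by apply: contraNneq q0 => e; rewrite hq e mul0r.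
exists (p %/ g), (q %/ g); split=> //; first by rewrite coprimep_div_gcd ?q0 ?orbT.
by rewrite {1}hp {1}hq !tofracM -mulf_div divff ?mulr1 // tofrac_eq0.
Qed.

Lemma eq_frac (R : idomainType) (p q p' q' : R) : q != 0 -> q' != 0 ->
  (p%:F / q%:F == p'%:F / q'%:F) = (p * q' == p' * q).
Proof. by move=> q0 q'0; rewrite eqr_div ?tofrac_eq0 // -!tofracM tofrac_eq. Qed.

Lemma frac_add (R : idomainType) (p q r s : R) : q != 0 -> s != 0 ->
  p%:F / q%:F + r%:F / s%:F = (p * s + r * q)%:F / (q * s)%:F.
Proof.
move=> q0 s0; rewrite tofracD !tofracM addf_div //.
  by rewrite tofrac_eq0.
by rewrite tofrac_eq0.
Qed.

Lemma frac_mul (R : idomainType) (p q r s : R) :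
  p%:F / q%:F * (r%:F / s%:F) = (p * r)%:F / (q * s)%:F.
Proof. by rewrite !tofracM mulf_div. Qed.

(** By induction on the size, divisors of smaller size are constant; a nonconstant [p] would thus be
    irreducible, and it divides itself. *)
Lemma size1_no_irreducible_factor (K : fieldType) (p : {poly K}) : p != 0 ->
  (forall d, irreducible_poly d -> ~~ (d %| p)) -> size p = 1%N.
Proof.
have [n] := ubnP (size p); elim: n => // n IH in p *; rewrite ltnS => le_n p0 hp.
apply/eqP/negPn/negP => p1.
suff irr_p : irreducible_poly p by have := hp p irr_p; rewrite dvdpp.
split; first by rewrite ltn_neqAle eq_sym p1 size_poly_gt0.
move=> q q1 qp; apply/negPn/negP => nqp; case/eqP: q1; apply: IH.
- apply: leq_trans le_n; rewrite ltn_neqAle dvdp_leq // andbT.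
  by rewrite dvdp_size_eqp.
- by apply: contraNneq p0 => q0; rewrite q0 dvd0p in qp.
- by move=> d hd; apply: contra (hp d hd) => dq; exact: dvdp_trans qp.
Qed.

(** * The valuation ring attached to an irreducible polynomial *)

Section AdicValuation.
Variable K : fieldType.
Hypothesis charK : forall n, n.+1%:R != 0 :> K.
Implicit Types (z w : {fraction {poly K}}) (p q : {poly K}).
Variable d : {poly K}.

(** For irreducible [d], the localisation of K[X] at the prime (d), followed by its maximal ideal.
    One suitable representation as a fraction suffices, not necessarily in lowest terms. *)
Definition adicO z := exists p q, ~~ (d %| q) /\ z = p%:F / q%:F.
Definition adicM z := exists p q, [/\ d %| p, ~~ (d %| q) & z = p%:F / q%:F].

Hypothesis irr_d : irreducible_poly d.

Lemma irredp_dvdM p q : (d %| p * q) = (d %| p) || (d %| q).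
Proof.
have [dp|ndp] := boolP (d %| p); first by rewrite dvdp_mulr.
by rewrite Gauss_dvdpr // irreducible_poly_coprime.
Qed.

Lemma ndvd_neq0 p : ~~ (d %| p) -> p != 0.
Proof. by apply: contraNneq => ->; rewrite dvdp0. Qed.

Lemma ndvd_const (c : K) : c != 0 -> ~~ (d %| c%:P).
Proof.
move=> c0; apply/negP => /dvdp_leq; rewrite polyC_eq0 size_polyC c0 => /(_ isT).
by apply/negP; rewrite -ltnNge; case: irr_d.
Qed.

Lemma adicO_poly p : adicO p%:F.
Proof.
by exists p, 1; rewrite tofrac1 divr1 -[1]/1%:P ndvd_const ?oner_neq0.
Qed.

Lemma adicM_dvd p : adicM p%:F -> d %| p.
Proof.
case=> r [s [dr nds /eqP]]; rewrite -[p%:F]divr1 -tofrac1.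
rewrite (eq_frac _ _ (oner_neq0 _) (ndvd_neq0 nds)) mulr1 => /eqP e.
by move: dr; rewrite -e irredp_dvdM (negbTE nds) orbF.
Qed.

Lemma adic_valuation_ring : valuation_ring adicO adicM.
Proof.
split.
- by move=> n; rewrite -[n%:R](rmorph_nat (@tofrac _)); exact: adicO_poly.
- move=> _ [p [q [ndq ->]]]; exists (- p), q; split=> //.
  by rewrite tofracN mulNr.
- move=> _ _ [p [q [ndq ->]]] [r [s [nds ->]]].
  exists (p * s + r * q), (q * s); rewrite irredp_dvdM negb_or ndq nds; split=> //.
  by apply: frac_add; exact: ndvd_neq0.
- move=> _ _ [p [q [ndq ->]]] [r [s [nds ->]]].
  exists (p * r), (q * s); rewrite irredp_dvdM negb_or ndq nds; split=> //.
  exact: frac_mul.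
- by move=> _ [p [q [_ ndq ->]]]; exists p, q.
- exists 0, 1; split; rewrite ?dvdp0 ?tofrac0 ?mul0r //.
  by rewrite -[1]/1%:P ndvd_const ?oner_neq0.
- move=> _ _ [p [q [dp ndq ->]]] [r [s [dr nds ->]]].
  exists (p * s + r * q), (q * s); split.
  + by rewrite dvdp_add ?dvdp_mulr.
  + by rewrite irredp_dvdM negb_or ndq nds.
  + by apply: frac_add; exact: ndvd_neq0.
- move=> _ _ [p [q [ndq ->]]] [r [s [dr nds ->]]].
  exists (p * r), (q * s); split.
  + by rewrite dvdp_mull.
  + by rewrite irredp_dvdM negb_or ndq nds.
  + exact: frac_mul.
- move=> n; rewrite -[n.+1%:R](rmorph_nat (@tofrac _)) => /adicM_dvd.
  by apply/negP; rewrite -polyC_natr ndvd_const.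
- move=> _ [p [q [ndq ->]]]; have [dp|ndp] := boolP (d %| p).
    by left; exists p, q.
  by right; exists q, p; rewrite invf_div.
(* In lowest terms [d] cannot divide both numerator and denominator. *)
- move=> z; have [p [q [q0 cpq ->]]] := frac_coprime z.
  have [dq|ndq] := boolP (d %| q); last by left; exists p, q.
  right; exists q, p; split; rewrite ?invf_div //.
  apply/negP => dp; have := coprimep_dvdr dp (coprimep_dvdl dq cpq).
  by rewrite irreducible_poly_coprime // dvdpp.
Qed.

Lemma adicM_mul z : adicM z -> exists2 w, adicO w & z = d%:F * w.
Proof.
case=> p [q [/dvdpP[r ->] ndq ->]]; exists (r%:F / q%:F); first by exists r, q.
by rewrite tofracM mulrAC mulrC.
Qed.

(** Both elements are [d] times an integral one, so the difference of squares is [d ^+ 2] times an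
    integral element, whose denominator is prime to [d]. *)
Lemma dvd_sqr_diff z w p : adicM z -> adicM w -> w ^+ 2 - z ^+ 2 = p%:F ->
  d ^+ 2 %| p.
Proof.
have vR := adic_valuation_ring.
move=> /adicM_mul[z' zO ->] /adicM_mul[w' wO ->] e.
have : adicO (w' ^+ 2 - z' ^+ 2) by apply: (vO_sub vR); exact: (vO_exp vR).
case=> r [s [nds ers]].
have s0 := ndvd_neq0 nds.
have {e} : p * s = d ^+ 2 * r.
  apply/eqP; rewrite -tofrac_eq (tofracM p s) (tofracM (d ^+ 2) r) -e tofracXn.
  have -> : (d%:F * w') ^+ 2 - (d%:F * z') ^+ 2 = d%:F ^+ 2 * (w' ^+ 2 - z' ^+ 2).
    by rewrite !exprMn mulrBr.
  by rewrite ers -mulrA divfK // tofrac_eq0.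
move=> e; have : d ^+ 2 %| p * s by rewrite e dvdp_mulr.
by rewrite Gauss_dvdpl // coprimep_expl // irreducible_poly_coprime.
Qed.

Lemma adicO_coprime p q : q != 0 -> coprimep p q -> adicO (p%:F / q%:F) ->
  ~~ (d %| q).
Proof.
move=> q0 cpq [r [s [nds /eqP]]]; rewrite (eq_frac _ _ q0 (ndvd_neq0 nds)) => /eqP e.
apply/negP => dq; have : d %| p * s by rewrite e dvdp_mull.
rewrite irredp_dvdM (negbTE nds) orbF => dp.
have := coprimep_dvdr dp (coprimep_dvdl dq cpq).
by rewrite irreducible_poly_coprime // dvdpp.
Qed.
End AdicValuation.

(** In lowest terms neither numerator nor denominator has an irreducible factor, so both are
    constants. *)
Lemma frac_const (K : fieldType) (z : {fraction {poly K}}) : z != 0 ->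
  (forall d, irreducible_poly d -> adicO d z /\ adicO d z^-1) ->
  exists c : K, z = c%:P%:F.
Proof.
have [p [q [q0 cpq ->]]] := frac_coprime z => z0 hz.
have p0 : p != 0 by apply: contraNneq z0 => ->; rewrite tofrac0 mul0r.
have q1 : size q = 1%N.
  apply: size1_no_irreducible_factor => // d hd; have [h _] := hz d hd.
  exact: adicO_coprime h.
have p1 : size p = 1%N.
  apply: size1_no_irreducible_factor => // d hd; have [_ h] := hz d hd.
  by rewrite invf_div in h; apply: adicO_coprime h => //; rewrite coprimep_sym.
have /eqP/size_poly1P[b b0 ->] := q1; have /eqP/size_poly1P[a a0 ->] := p1.
exists (a / b); apply: (canLR (mulfK _)); first by rewrite tofrac_eq0 polyC_eq0.
by rewrite -tofracM -polyCM divfK.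
Qed.

(** If [d ^+ 2] divided [p], then [d] would divide [p] and its derivative, hence the given
    combination. *)
Lemma irreducible_sqr_not_dvd (K : fieldType) (d p u v : {poly K}) :
  irreducible_poly d -> coprimep d (u * p + v * p^`()) -> ~~ (d ^+ 2 %| p).
Proof.
move=> hd; rewrite irreducible_poly_coprime //; apply: contra => /dvdpP[r hr].
rewrite hr derivM deriv_exp.
apply: dvdp_add; apply: dvdp_mull; first by rewrite dvdp_mull // dvdp_exp.
apply: dvdp_add; apply: dvdp_mull; first exact: dvdp_exp.
by rewrite -mulrnAl expr1 dvdp_mull.
Qed.

Lemma frac_sqr_lead_coef (K : fieldType) (z : {fraction {poly K}}) (p : {poly K}) :
  z ^+ 2 = p%:F -> exists r : K, r ^+ 2 = lead_coef p.
Proof.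
have [r [s [s0 ->]]] := frac_numden z => e.
have : r ^+ 2 = p * s ^+ 2.
  apply/eqP; rewrite -tofrac_eq (tofracM p (s ^+ 2)) -e !tofracXn expr_div_n divfK //.
  by rewrite expf_neq0 // tofrac_eq0.
move/(congr1 lead_coef); rewrite (lead_coefM p) !lead_coef_exp => {}e.
exists (lead_coef r / lead_coef s).
by rewrite expr_div_n e mulfK // expf_neq0 // lead_coef_eq0.
Qed.

(** One Horner step; iterated, it reads the leading coefficient off a Horner form. *)
Lemma lead_coef_MXadd (R : nzRingType) (a : R) (p q : {poly R}) : a != 0 ->
  (size q <= 1)%N -> lead_coef p = a -> lead_coef (p * 'X + q) = a.
Proof.
move=> a0 q1 pa; have p0 : p != 0 by rewrite -lead_coef_eq0 pa.
rewrite lead_coefDl ?lead_coefMX //.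
by rewrite size_mulX // ltnS (leq_trans q1) // size_poly_gt0.
Qed.

(** The 3-adic valuation of 60 is 1, whereas that of a square is even. *)
Lemma rat_sqr_neq60 (r : rat) : r ^+ 2 != 60%:R.
Proof.
apply/eqP => e.
have d0 := denq_neq0 r.
have : numq r ^+ 2 = 60%:R * denq r ^+ 2.
  apply: (@intr_inj rat); rewrite [LHS]rmorphXn [RHS]rmorphM rmorph_nat -e.
  rewrite [X in _ = _ * X]rmorphXn -exprMn -[X in X * _]divq_num_den.
  by rewrite divfK ?intr_eq0.
move/(congr1 absz); rewrite abszM !abszX => /(congr1 (logn 3)).
have d2 : (0 < `|denq r| ^ 2)%N by rewrite expn_gt0 absz_gt0 d0.
rewrite lognX (@lognM 3 60 _ isT d2) lognX.
by move/(congr1 odd); rewrite oddD !mul2n !odd_double.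
Qed.

(** * The curve *)

Lemma cubic_factor (F : fieldType) (e1 e2 e3 x : F) :
  x ^+ 3 + (e1 + e2 + e3) * x ^+ 2 + (e1 * e2 + e2 * e3 + e3 * e1) * x
  + e1 * e2 * e3 = (x + e1) * (x + e2) * (x + e3).
Proof. by ring. Qed.

Lemma double_sub_root_sqr (F : fieldType) (e1 e2 e3 x y : F)
    (a2 := e1 + e2 + e3) (a4 := e1 * e2 + e2 * e3 + e3 * e1) :
  2%:R != 0 :> F -> y != 0 -> on_curve a2 a4 (e1 * e2 * e3) (Pt x y) ->
  exists X Y u1 u2 u3, [/\ add_pt a2 a4 (Pt x y) (Pt x y) = Pt X Y,
    u1 ^+ 2 = X + e1, u2 ^+ 2 = X + e2 & u3 ^+ 2 = X + e3].
Proof.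
move=> t0 y0; rewrite /on_curve cubic_factor => hy.
have [l hl] := tangent_slope a2 a4 t0 x y0.
have z0 : (2%:R * y) ^+ 2 != 0 by rewrite expf_neq0 ?mulf_neq0.
(* The duplication formula in its classical 2-descent form; cyclic permutations of the roots give
   the three squares. *)
have root_sqr e f g : e + f + g = a2 -> e * f + f * g + g * e = a4 ->
    y ^+ 2 = (x + e) * (x + f) * (x + g) ->
    (((x + e) ^+ 2 - (f - e) * (g - e)) / (2%:R * y)) ^+ 2
    = l ^+ 2 - a2 - x - x + e.
  move=> h2 h4 hy'; apply: (mulIf z0); rewrite expr_div_n divfK //.
  transitivity ((l * (2%:R * y)) ^+ 2 + (- a2 - x - x + e) * 4%:R * y ^+ 2);
    last by ring.
  by rewrite hl hy' -h2 -h4; ring.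
eexists _, _, _, _, _; split; first exact: (add_pt_tangent t0 y0 hl).
- exact: (@root_sqr e1 e2 e3).
- by apply: (@root_sqr e2 e3 e1); rewrite ?hy /a2 /a4; ring.
- by apply: (@root_sqr e3 e1 e2); rewrite ?hy /a2 /a4; ring.
Qed.

(** * The polynomials a, b, c and the differences of their products *)

Definition pa : {poly rat} := 10%:R * 'X ^+ 2 - 8%:R * 'X + 8%:R.
Definition pb : {poly rat} := 'X * ('X ^+ 2 - 4%:R * 'X + 20%:R).
Definition pc : {poly rat} := ('X + 2%:R) * ('X ^+ 2 - 4%:R).

Lemma akE : ak = pa%:F.
Proof. by rewrite /ak /kk /pa !(rmorphD, rmorphN, rmorphM, rmorphXn, rmorph_nat). Qed.
Lemma bkE : bk = pb%:F.
Proof. by rewrite /bk /kk /pb !(rmorphD, rmorphN, rmorphM, rmorphXn, rmorph_nat). Qed.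
Lemma ckE : ck = pc%:F.
Proof. by rewrite /ck /kk /pc !(rmorphD, rmorphN, rmorphM, rmorphXn, rmorph_nat). Qed.

Lemma e1E : e1 = (pa * pb)%:F. Proof. by rewrite /e1 akE bkE -(tofracM pa pb). Qed.
Lemma e2E : e2 = (pb * pc)%:F. Proof. by rewrite /e2 bkE ckE -(tofracM pb pc). Qed.
Lemma e3E : e3 = (pa * pc)%:F. Proof. by rewrite /e3 akE ckE -(tofracM pa pc). Qed.

Lemma coprimep_nat (d : {poly rat}) n : irreducible_poly d -> coprimep d n.+1%:R.
Proof.
by move=> hd; rewrite irreducible_poly_coprime // -polyC_natr ndvd_const // pnatr_eq0.
Qed.

Lemma deriv_nat n : n%:R^`() = 0 :> {poly rat}.
Proof. by rewrite -polyC_natr derivC. Qed.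

Lemma deriv_pa : pa^`() = 20%:R * 'X - 8%:R.
Proof. by rewrite /pa !(deriv_nat, derivXn, derivX, derivB, derivD, derivM) /=; ring. Qed.

Lemma deriv_pb : pb^`() = 3%:R * 'X ^+ 2 - 8%:R * 'X + 20%:R.
Proof. by rewrite /pb !(deriv_nat, derivXn, derivX, derivB, derivD, derivM) /=; ring. Qed.

Lemma deriv_pc : pc^`() = 3%:R * 'X ^+ 2 + 4%:R * 'X - 4%:R.
Proof. by rewrite /pc !(deriv_nat, derivXn, derivX, derivB, derivD, derivM) /=; ring. Qed.

(* The Bezout coefficients of [p] and its derivative come from the extended
   Euclidean algorithm. *)
Lemma sqr_not_dvd_e2e1 d : irreducible_poly d -> ~~ (d ^+ 2 %| pb * pc - pa * pb).
Proof.
move=> hd; set p := _ - _.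
have dp : p^`() = pb^`() * (pc - pa) + pb * (pc^`() - pa^`()).
  by rewrite derivB !derivM; ring.
apply: (@irreducible_sqr_not_dvd _ d p
  (- 4140064%:R + 6235488%:R * 'X - 2374032%:R * 'X ^+ 2 + 587160%:R * 'X ^+ 3
   - 55458%:R * 'X ^+ 4)
  (- 2375680%:R + 2001952%:R * 'X - 2020536%:R * 'X ^+ 2 + 579068%:R * 'X ^+ 3
   - 116346%:R * 'X ^+ 4 + 9243%:R * 'X ^+ 5) hd).
rewrite dp deriv_pa deriv_pb deriv_pc.
(* The combination is a nonzero constant, written through small numerals to which [coprimep_nat]
   applies. *)
set r := _ + _; have -> : r = 2%:R ^+ 20 * 5%:R ^+ 2 * 29%:R.
  by rewrite /r /p /pa /pb /pc; ring.
by rewrite coprimepMr (coprimepMr d (2%:R ^+ 20)) !coprimep_expr ?coprimep_nat.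
Qed.

Lemma sqr_not_dvd_e3e1 d : irreducible_poly d -> ~~ (d ^+ 2 %| pa * pc - pa * pb).
Proof.
move=> hd; set p := _ - _.
have dp : p^`() = pa^`() * (pc - pb) + pa * (pc^`() - pb^`()).
  by rewrite derivB !derivM; ring.
apply: (@irreducible_sqr_not_dvd _ d p
  (- 3344%:R + 2352%:R * 'X - 420%:R * 'X ^+ 2)
  (- 376%:R + 1228%:R * 'X - 714%:R * 'X ^+ 2 + 105%:R * 'X ^+ 3) hd).
rewrite dp deriv_pa deriv_pb deriv_pc.
set r := _ + _; have -> : r = 2%:R ^+ 18 by rewrite /r /p /pa /pb /pc; ring.
by rewrite coprimep_expr ?coprimep_nat.
Qed.

Lemma size_natr_leq1 n : (size (n%:R : {poly rat}) <= 1)%N.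
Proof. by rewrite -polyC_natr size_polyC_leq1. Qed.

(** The cubic terms of [pc] and [pb] cancel, leaving a(c - b) with leading term 60 X^4. The constant
    [c] stands for a possible constant value of [u1 ^+ 2]. *)
Lemma lead_coef_e3e1_add (c : rat) :
  lead_coef (pa * pc - pa * pb + c%:P) = 60%:R.
Proof.
have -> : pa * pc - pa * pb + c%:P = (((60%:R * 'X - 288%:R) * 'X
    + 160%:R) * 'X - 128%:R) * 'X + (c%:P - 64%:R).
  by rewrite /pa /pb /pc; ring.
apply: lead_coef_MXadd => //.
  by rewrite -polyC_natr -polyCN -polyCD size_polyC_leq1.
do 3! (apply: lead_coef_MXadd; [by []|by rewrite ?size_polyN size_natr_leq1|]).
by rewrite -polyC_natr lead_coefC.
Qed.

Lemma lead_coef_e1e2 : lead_coef (pa * pb - pb * pc) = - 1.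
Proof.
have -> : pa * pb - pb * pc = (((((- 1 * 'X + 12%:R) * 'X - 56%:R) * 'X
    + 192%:R) * 'X - 144%:R) * 'X + 320%:R) * 'X + 0%:R.
  by rewrite /pa /pb /pc; ring.
do 6! (apply: lead_coef_MXadd; [by []|by rewrite ?size_polyN size_natr_leq1|]).
by rewrite lead_coefN lead_coef1.
Qed.

Lemma Qk_natf_neq0 n : n.+1%:R != 0 :> Qk.
Proof.
by rewrite -[n.+1%:R](rmorph_nat (@tofrac _)) tofrac_eq0 -polyC_natr polyC_eq0 pnatr_eq0.
Qed.

(** Evaluation at 1 separates the products ab, bc and ac: their values are 170, -153 and -90. *)
Lemma tofrac_neq (p q : {poly rat}) : p.[1] != q.[1] -> p%:F != q%:F.
Proof. by rewrite tofrac_eq; apply: contraNneq => ->. Qed.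

Lemma horner_pa : pa.[1] = 10%:R.
Proof. by rewrite /pa !hornerE. Qed.
Lemma horner_pb : pb.[1] = 17%:R.
Proof. by rewrite /pb !hornerE. Qed.
Lemma horner_pc : pc.[1] = - 9%:R.
Proof. by rewrite /pc !hornerE. Qed.

Lemma e1_neq_e2 : e1 != e2.
Proof.
rewrite e1E e2E; apply: tofrac_neq.
by rewrite (hornerM pa pb) (hornerM pb pc) horner_pa horner_pb horner_pc.
Qed.
Lemma e1_neq_e3 : e1 != e3.
Proof.
rewrite e1E e3E; apply: tofrac_neq.
by rewrite (hornerM pa pb) (hornerM pa pc) horner_pa horner_pb horner_pc.
Qed.
Lemma e2_neq_e3 : e2 != e3.
Proof.
rewrite e2E e3E; apply: tofrac_neq.
by rewrite (hornerM pb pc) (hornerM pa pc) horner_pa horner_pb horner_pc.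
Qed.

Lemma torsion_y_eq0 x y : torsion_pt A2 A4 A6 (Pt x y) -> y = 0.
Proof.
move=> tP; apply/eqP/negPn/negP => y0.
have t0 := Qk_natf_neq0 1.
have [X [Y [u1 [u2 [u3 [eR hu1 hu2 hu3]]]]]] := double_sub_root_sqr t0 y0 tP.1.
have := torsion_double t0 tP; rewrite eR => tR {eR tP y0 x y}.
have e21 : u2 ^+ 2 - u1 ^+ 2 = (pb * pc - pa * pb)%:F.
  rewrite hu1 hu2 (tofracB (pb * pc)) -e1E -e2E.
  by rewrite (addrC X e2) addrKA.
have e31 : u3 ^+ 2 - u1 ^+ 2 = (pa * pc - pa * pb)%:F.
  rewrite hu1 hu3 (tofracB (pa * pc)) -e1E -e3E.
  by rewrite (addrC X e3) addrKA.
(* Otherwise [u3 ^+ 2] would be a polynomial with leading coefficient 60, not a rational square. *)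
have u1_not_const c : u1 <> c%:P%:F.
  move=> hc; have : u3 ^+ 2 = (pa * pc - pa * pb + (c ^+ 2)%:P)%:F.
    by rewrite (tofracD (pa * pc - pa * pb)) -e31 polyC_exp tofracXn -hc subrK.
  move=> /frac_sqr_lead_coef[r]; rewrite lead_coef_e3e1_add.
  by apply/eqP/rat_sqr_neq60.
have u10 : u1 != 0 by apply/eqP; rewrite -tofrac0 -[0]/0%:P; exact: u1_not_const.
(* If [Y = 0] then [u2] or [u3] vanishes, so [u1 ^+ 2] is b(a - c) or -a(c - b), with negative
   leading coefficient -1 or -60. *)
have [Y0|Y0] := eqVneq Y 0.
  have : (u2 * u3) ^+ 2 == 0.
    have : (u1 * (u2 * u3)) ^+ 2 = 0.
      rewrite !exprMn hu1 hu2 hu3 mulrA -cubic_factor.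
      by case: tR => /= <- _; rewrite Y0 expr0n.
    by move/eqP; rewrite exprMn mulf_eq0 expf_eq0 (negbTE u10) andbF.
  rewrite expf_eq0 /= mulf_eq0 => /orP[/eqP u0|/eqP u0].
    have : u1 ^+ 2 = (pa * pb - pb * pc)%:F.
      by rewrite -opprB tofracN -e21 u0 expr0n sub0r opprK.
    move=> /frac_sqr_lead_coef[r]; rewrite lead_coef_e1e2 => h.
    by have := sqr_ge0 r; rewrite h.
  have : u1 ^+ 2 = (- (pa * pc - pa * pb + 0%:P))%:F.
    by rewrite addr0 tofracN -e31 u0 expr0n sub0r opprK.
  move=> /frac_sqr_lead_coef[r]; rewrite lead_coefN lead_coef_e3e1_add => h.
  by have := sqr_ge0 r; rewrite h oppr_ge0 leNgt ltr0n.
(* At every irreducible [d] the element [u1] is a unit: otherwise [d ^+ 2] would divide b(c - a) or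
   a(c - b). *)
have [c hc] : exists c : rat, u1 = c%:P%:F.
  apply: (frac_const u10) => d hd.
  have char0 n : n.+1%:R != 0 :> rat by rewrite pnatr_eq0.
  have vR := adic_valuation_ring char0 hd.
  have [|||u1O _ _ node] := torsion_double_node vR _ _ _ Y0 tR hu1 hu2 hu3.
  - by rewrite e1E; exact: adicO_poly.
  - by rewrite e2E; exact: adicO_poly.
  - by rewrite e3E; exact: adicO_poly.
  split; first exact: u1O.
  have [u1M|u1V] := vO_unit vR u1O; last exact: u1V.
  case: (node u1M) => uM.
    by have := dvd_sqr_diff char0 hd u1M uM e21; rewrite (negbTE (sqr_not_dvd_e2e1 hd)).
  by have := dvd_sqr_diff char0 hd u1M uM e31; rewrite (negbTE (sqr_not_dvd_e3e1 hd)).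
exact: (u1_not_const c).
Qed.

(** * The subgroup of 2-torsion points *)

Lemma Z2_dichotomy (u : 'Z_2) : u = 0 \/ u = 1.
Proof. by case: u => [[|[|//]] hu]; [left|right]; apply: val_inj. Qed.

Section TwoTorsion.
Variables (F : fieldType) (e1 e2 e3 : F).
Hypotheses (n12 : e1 != e2) (n13 : e1 != e3) (n23 : e2 != e3).
Let a2 := e1 + e2 + e3.
Let a4 := e1 * e2 + e2 * e3 + e3 * e1.
Let a6 := e1 * e2 * e3.

(** The roots of the cubic are the [- e_i]; (1, 1) goes to the third one because the three points
    lie on the line y = 0 and so sum to zero. *)
Definition two_torsion (u : 'Z_2 * 'Z_2) : point F :=
  if u.1 == 0 then if u.2 == 0 then Inf else Pt (- e2) 0
  else if u.2 == 0 then Pt (- e1) 0 else Pt (- e3) 0.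

Lemma add_two_torsion x1 x2 : x1 != x2 ->
  add_pt a2 a4 (Pt x1 0) (Pt x2 0) = Pt (- a2 - x1 - x2) 0.
Proof.
move=> h; rewrite (@add_pt_chord _ _ _ 0) // ?mul0r ?subrr //.
by congr Pt; ring.
Qed.

Lemma two_torsion_inj : injective two_torsion.
Proof.
move=> [u v] [u' v']; rewrite /two_torsion.
have [->|->] := Z2_dichotomy u; have [->|->] := Z2_dichotomy v;
have [->|->] := Z2_dichotomy u'; have [->|->] := Z2_dichotomy v' => //= -[] /oppr_inj e;
  by move: n12 n13 n23; rewrite e eqxx.
Qed.

Lemma two_torsionD u v :
  two_torsion (u + v) = add_pt a2 a4 (two_torsion u) (two_torsion v).
Proof.
have h x1 x2 x3 : x1 != x2 -> - a2 - - x1 - - x2 = - x3 ->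
    Pt (- x3) 0 = add_pt a2 a4 (Pt (- x1) 0) (Pt (- x2) 0).
  by move=> h <-; rewrite add_two_torsion ?(inj_eq oppr_inj).
have hd x : add_pt a2 a4 (Pt x 0) (Pt x 0) = Inf by exact: add_pt_double_eq0.
have hl P : add_pt a2 a4 Inf P = P by [].
have hr P : add_pt a2 a4 P Inf = P by case: P.
(* Addition is made abstract, so that simplification in the sixteen cases does not unfold it. *)
move: (add_pt a2 a4) h hd hl hr => add h hd hl hr.
case: u v => [u v] [u' v']; rewrite /two_torsion.
have [->|->] := Z2_dichotomy u; have [->|->] := Z2_dichotomy v;
have [->|->] := Z2_dichotomy u'; have [->|->] := Z2_dichotomy v';
  rewrite /= ?hd ?hl ?hr //; apply: h; rewrite // 1?eq_sym // /a2; ring.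
Qed.

Lemma two_torsion_torsion u : torsion_pt a2 a4 a6 (two_torsion u).
Proof.
have h x : (x + e1) * (x + e2) * (x + e3) = 0 -> torsion_pt a2 a4 a6 (Pt x 0).
  move=> hx; split; first by rewrite /on_curve cubic_factor hx expr0n.
  by exists 2%N; split=> //; rewrite mul_ptS add_pt_double_eq0.
case: u => u v; rewrite /two_torsion; case: eqP => _; case: eqP => _.
- by split=> //; exists 1%N.
- by apply: h; rewrite addNr mulr0 mul0r.
- by apply: h; rewrite addNr !mul0r.
- by apply: h; rewrite addNr mulr0.
Qed.

Lemma on_curve_two_torsion x : on_curve a2 a4 a6 (Pt x 0) ->
  exists u, two_torsion u = Pt x 0.
Proof.
rewrite /on_curve cubic_factor expr0n => /esym/eqP; rewrite !mulf_eq0 -orbA.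
case/or3P; rewrite addr_eq0 => /eqP ->.
- by exists (1, 0).
- by exists (0, 1).
- by exists (1, 1).
Qed.
End TwoTorsion.

Theorem theorem4p1 :
  torsion_iso A2 A4 A6 ('Z_2 * 'Z_2)%type.
Proof.
exists (two_torsion e1 e2 e3); split.
- exact: two_torsion_inj e1_neq_e2 e1_neq_e3 e2_neq_e3.
- by move=> u; have [] := two_torsion_torsion e1 e2 e3 u.
- exact: two_torsionD e1_neq_e2 e1_neq_e3 e2_neq_e3.
move=> P; split; last by case=> u <-; exact: two_torsion_torsion.
case: P => [_|x y tP]; first by exists 0.
move: (tP); rewrite (torsion_y_eq0 tP) => -[] hP _.
exact: on_curve_two_torsion.
Qed.
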